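(* SESs are strictly less expressive than RCESs: for every SES $\sigma$ there is an RCES that is transition equivalent to $\sigma$, and there is an RCES that is not transition equivalent to any SES.
   Context: An SES is a tuple $\sigma=(E,\#,\to,\mathrm{Drop})$: $E$ a set of events, $\#\subseteq E^2$ irreflexive and symmetric, $\to\subseteq E^2$, $\mathrm{Drop}\subseteq E^3$ with $(d,c,t)\in\mathrm{Drop}$ implying $c\to t$ and $d\notin\{c,t\}$. Let $\mathrm{ic}(e)=\{e'\mid e'\to e\}$, $\mathrm{dc}(H,e)=\{e'\mid\exists d\in H.(d,e',e)\in\mathrm{Drop}\}$. $X\mapsto_\sigma Y$ iff $X\subsetneq Y$, no two events of $Y$ are in conflict, and $\mathrm{ic}(e)\setminus\mathrm{dc}(X,e)\subseteq X$ for all $e\in Y\setminus X$; $\mathcal C(\sigma)$ is the set of finite $X\subseteq E$ with $\emptyset\mapsto_\sigma^* X$. An Event Structure for Resolvable Conflicts (RCES) is $\rho=(E,\vdash)$ with $E$ a set of events and $\vdash\subseteq\mathcal P(E)^2$. For $X,Y\subseteq E$: $X\mapsto_\rho Y$ iff $X\subsetneq Y$ and for every $Z\subseteq Y$ there is $W\subseteq X$ with $W\vdash Z$. $\mathcal C(\rho)$ is the set of finite $X$ with $\emptyset\mapsto_\rho^*X$. Two structures $\mu_1,\mu_2$ of these kinds are transition equivalent if they have the same reachable transition graph: $\mathcal C(\mu_1)=\mathcal C(\mu_2)$ and $\mapsto_{\mu_1}\cap\,\mathcal C(\mu_1)^2=\mapsto_{\mu_2}\cap\,\mathcal C(\mu_2)^2$.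 *)

(* Defs.v *)
From mathcomp Require Import all_boot.
From mathcomp Require Import boolp classical_sets functions cardinality.
From Stdlib Require Import Relation_Operators.

Set Implicit Arguments.
Unset Strict Implicit.
Unset Printing Implicit Defensive.

Local Open Scope classical_set_scope.

(* Event sets are arbitrary subsets of an ambient type U, so that structures
   with different event sets can be compared by plain equality of their
   configurations and transitions. *)

(* What SESs and RCESs have in common: a set of events together with a
   transition relation on sets of events. *)
Record tstruct (U : Type) := TStruct {
  events : set U;
  step : set U -> set U -> Prop
}.

Definition configs (U : Type) (mu : tstruct U) : set (set U) :=
  [set X | [/\ X `<=` events mu, finite_set X &
               clos_refl_trans (set U) (step mu) set0 X]].

Definition reach_steps (U : Type) (mu : tstruct U) : set (set U * set U) :=
  [set p | step mu p.1 p.2] `&` (configs mu `*` configs mu).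

Definition trans_equiv (U : Type) (mu1 mu2 : tstruct U) : Prop :=
  configs mu1 = configs mu2 /\ reach_steps mu1 = reach_steps mu2.

Record SES (U : Type) := MkSES {
  ses_E : set U;
  ses_conf : U -> U -> Prop;
  ses_caus : U -> U -> Prop;
  ses_drop : U -> U -> U -> Prop;
  ses_confE : forall e e', ses_conf e e' -> ses_E e /\ ses_E e';
  ses_conf_irr : forall e, ~ ses_conf e e;
  ses_conf_sym : forall e e', ses_conf e e' -> ses_conf e' e;
  ses_causE : forall e e', ses_caus e e' -> ses_E e /\ ses_E e';
  ses_dropE : forall d c t, ses_drop d c t -> [/\ ses_E d, ses_E c & ses_E t];
  ses_dropP : forall d c t,
    ses_drop d c t -> ses_caus c t /\ ~ [set c; t] d
}.

Definition ses_ic (U : Type) (s : SES U) (e : U) : set U :=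
  [set e' | ses_caus s e' e].

Definition ses_dc (U : Type) (s : SES U) (H : set U) (e : U) : set U :=
  [set e' | exists2 d, H d & ses_drop s d e' e].

Definition ses_step (U : Type) (s : SES U) (X Y : set U) : Prop :=
  [/\ Y `<=` ses_E s,
      X `<` Y,
      forall e e', Y e -> Y e' -> ~ ses_conf s e e' &
      forall e, (Y `\` X) e -> ses_ic s e `\` ses_dc s X e `<=` X].

Definition ses_ts (U : Type) (s : SES U) : tstruct U :=
  TStruct (ses_E s) (ses_step s).

Record RCES (U : Type) := MkRCES {
  rces_E : set U;
  rces_en : set U -> set U -> Prop;
  rces_enE : forall W Z, rces_en W Z -> W `<=` rces_E /\ Z `<=` rces_E
}.

Definition rces_step (U : Type) (r : RCES U) (X Y : set U) : Prop :=
  [/\ Y `<=` rces_E r,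
      X `<` Y &
      forall Z, Z `<=` Y -> exists2 W, W `<=` X & rces_en r W Z].

Definition rces_ts (U : Type) (r : RCES U) : tstruct U :=
  TStruct (rces_E r) (rces_step r).

(* Main.v *)
(* In an SES the enabling of an event is monotone in the set of events that have
   already occurred: more events means more satisfied causes and more droppers.
   Two consequences give the two halves of the theorem.
   - Every event of a configuration is enabled by that configuration, so a step
     from [X] to [Y] only asks that [Y] be conflict-free and that [X] enable all
     of [Y].  This condition passes from [Y] to its subsets and from [X] to its
     supersets, hence it is the step relation of an RCES.
   - Steps from [X] to [Y1] and to [Y2] can be merged into one step to
     [Y1 `|` Y2] as soon as the latter is a configuration, since it is then
     conflict-free.  RCESs need not have this property: it fails when the events
     can occur in any order, but only one at a time. *)
Require Import Defs.
From mathcomp Require Import all_boot.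
From mathcomp Require Import boolp classical_sets functions cardinality.
From Stdlib Require Import Relation_Operators Operators_Properties.

Set Implicit Arguments.
Unset Strict Implicit.
Unset Printing Implicit Defensive.

Local Open Scope classical_set_scope.

Lemma is_subset1_finite (T : Type) (A : set T) : is_subset1 A -> finite_set A.
Proof.
move=> A1; have [->|/set0P[a Aa]] := eqVneq A set0; first exact: finite_set0.
by apply: sub_finite_set (finite_set1 a) => b /A1; apply.
Qed.

Section TransitionStructures.
Variable U : Type.
Implicit Types (mu : tstruct U) (X Y : set U) (I : set (set U)).

Definition reachable mu : set (set U) :=
  [set X | clos_refl_trans (set U) (step mu) set0 X].

Lemma reachable0 mu : reachable mu set0.
Proof. exact: rt_refl. Qed.

Lemma reachable_step mu X Y : reachable mu X -> step mu X Y -> reachable mu Y.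
Proof. by move=> X0 XY; apply: rt_trans X0 (rt_step _ _ _ _ XY). Qed.

Lemma reachable_sub_invariant mu I :
  I set0 -> (forall X Y, I X -> step mu X Y -> I Y) -> reachable mu `<=` I.
Proof.
move=> I0 Istep X /(clos_rt_rtn1 _ _ _ _).
by elim=> // Y Z YZ _ IY; apply: Istep IY YZ.
Qed.

Lemma configs0 mu : configs mu set0.
Proof. by split; [exact: sub0set | exact: finite_set0 | exact: reachable0]. Qed.

Lemma trans_equivP mu1 mu2 :
  trans_equiv mu1 mu2 <->
  configs mu1 = configs mu2 /\
  (forall X Y, configs mu1 X -> configs mu1 Y ->
     step mu1 X Y <-> step mu2 X Y).
Proof.
split=> -[C12 S12]; split=> //.
- move=> X Y CX CY; split=> XY.
  + by have: reach_steps mu1 (X, Y) by []; rewrite S12 => -[].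
  + have: reach_steps mu2 (X, Y) by rewrite /reach_steps -C12.
    by rewrite -S12 => -[].
- rewrite /reach_steps -C12; apply/seteqP.
  by split=> -[X Y] [/= XY [CX CY]]; split=> //; apply/S12.
Qed.

Lemma trans_equiv_invariant mu1 mu2 I :
  events mu1 = events mu2 -> I set0 ->
  (forall X Y, I X -> step mu1 X Y -> I Y) ->
  (forall X Y, I X -> step mu1 X Y <-> step mu2 X Y) ->
  trans_equiv mu1 mu2.
Proof.
move=> E12 I0 Istep S12.
have R12 : reachable mu1 `<=` reachable mu2 `&` I.
  apply: reachable_sub_invariant => [|X Y [RX IX] XY].
    by split=> //; exact: reachable0.
  by split; [apply: reachable_step RX _; apply/S12 | apply: Istep IX XY].
have R21 : reachable mu2 `<=` reachable mu1 `&` I.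
  apply: reachable_sub_invariant => [|X Y [RX IX] /(S12 _ _ IX) XY].
    by split=> //; exact: reachable0.
  by split; [apply: reachable_step RX XY | apply: Istep IX XY].
apply/trans_equivP; split; last by move=> X Y [_ _ /R12[_ IX]] _; apply: S12.
apply/seteqP; split=> X [XE Xfin].
- by move=> /R12[RX _]; split; rewrite -?E12.
- by move=> /R21[RX _]; split; rewrite ?E12.
Qed.

End TransitionStructures.

Section SES.
Variables (U : Type) (s : SES U).
Implicit Types (W X Y Z : set U) (e : U).

Definition ses_enabled X : set U :=
  [set e | ses_ic s e `\` ses_dc s X e `<=` X].

Definition conflict_free X : Prop :=
  forall e e', X e -> X e' -> ~ ses_conf s e e'.

Lemma ses_enabledS X Y : X `<=` Y -> ses_enabled X `<=` ses_enabled Y.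
Proof.
move=> XY e Xe c [ce ndc]; apply/XY/Xe; split=> // -[d Xd dce].
by apply: ndc; exists d => //; apply: XY.
Qed.

Lemma configs_conflict_free X : configs (ses_ts s) X -> conflict_free X.
Proof.
by move=> [_ _]; apply: reachable_sub_invariant X => // X Y _ [].
Qed.

Lemma ses_stepU X Y1 Y2 :
  conflict_free (Y1 `|` Y2) -> ses_step s X Y1 -> ses_step s X Y2 ->
  ses_step s X (Y1 `|` Y2).
Proof.
move=> cfY [Y1E [XY1 nY1X] _ en1] [Y2E _ _ en2]; split=> //.
- by rewrite subUset.
- split; first by move=> e /XY1; left.
  by rewrite subUset => -[].
- by move=> e [[Y1e|Y2e] nXe]; [apply: en1 | apply: en2].
Qed.

Lemma trans_equiv_ses_stepU (mu : tstruct U) X Y1 Y2 :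
  trans_equiv mu (ses_ts s) ->
  configs mu X -> configs mu Y1 -> configs mu Y2 -> configs mu (Y1 `|` Y2) ->
  step mu X Y1 -> step mu X Y2 -> step mu X (Y1 `|` Y2).
Proof.
move=> /trans_equivP[Cmu_s Smu_s] CX C1 C2 C12.
move=> /(Smu_s _ _ CX C1) XY1 /(Smu_s _ _ CX C2) XY2.
apply/(Smu_s _ _ CX C12)/ses_stepU => //.
by apply: configs_conflict_free; rewrite -Cmu_s.
Qed.

Definition ses_self_enabled X : Prop := X `<=` ses_E s /\ X `<=` ses_enabled X.

Lemma ses_step_enabled X Y :
  ses_self_enabled X -> ses_step s X Y -> Y `<=` ses_enabled X.
Proof.
move=> [_ Xen] [_ _ _ YX] e Ye.
by have [/Xen//|nXe] := pselect (X e); apply: YX.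
Qed.

Lemma ses_step_self_enabled X Y :
  ses_self_enabled X -> ses_step s X Y -> ses_self_enabled Y.
Proof.
move=> Xen XY; have [YE [sXY _] _ _] := XY; split=> //.
exact: subset_trans (ses_step_enabled Xen XY) (ses_enabledS sXY).
Qed.

Definition ses_en W Z : Prop :=
  [/\ W `<=` ses_E s, Z `<=` ses_E s, conflict_free Z & Z `<=` ses_enabled W].

Lemma ses_enE W Z : ses_en W Z -> W `<=` ses_E s /\ Z `<=` ses_E s.
Proof. by case. Qed.

Definition rces_of_ses : RCES U := MkRCES ses_enE.

Lemma rces_of_ses_stepE X Y :
  ses_self_enabled X -> ses_step s X Y <-> rces_step rces_of_ses X Y.
Proof.
move=> Xen; split=> [XY|[YE sXY XY]].
- have [YE sXY cfY _] := XY; split=> // Z ZY; exists X => //; split.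
  + by case: Xen.
  + exact: subset_trans ZY YE.
  + by move=> e e' /ZY Ye /ZY; apply: cfY.
  + exact: subset_trans ZY (ses_step_enabled Xen XY).
- have [W WX [_ _ cfY Yen]] := XY Y (@subset_refl _ Y).
  by split=> // e [/Yen We _]; apply: ses_enabledS WX _ We.
Qed.

Lemma trans_equiv_rces_of_ses : trans_equiv (ses_ts s) (rces_ts rces_of_ses).
Proof.
apply: (@trans_equiv_invariant _ _ _ ses_self_enabled) => //.
- by split; apply: sub0set.
- exact: ses_step_self_enabled.
- exact: rces_of_ses_stepE.
Qed.

End SES.

Section Interleaving.
Variables (U : Type) (E : set U).
Implicit Types (W X Y Z : set U) (x y : U).

Definition interleaving_en W Z : Prop :=
  [/\ W `<=` E, Z `<=` E & is_subset1 (Z `\` W)].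

Lemma interleaving_enE W Z : interleaving_en W Z -> W `<=` E /\ Z `<=` E.
Proof. by case. Qed.

Definition interleaving_rces : RCES U := MkRCES interleaving_enE.

Lemma interleaving_stepE X Y :
  rces_step interleaving_rces X Y <->
  [/\ Y `<=` E, X `<` Y & is_subset1 (Y `\` X)].
Proof.
split=> [[YE sXY XY]|[YE sXY YX1]]; split=> //.
- have [W WX [_ _ YW1]] := XY Y (@subset_refl _ Y).
  by move=> x y [Yx nXx] [Yy nXy]; apply: YW1; split=> // /WX.
- move=> Z ZY; exists X => //; split.
  + exact: subset_trans (properW sXY) YE.
  + exact: subset_trans ZY YE.
  + by move=> x y [/ZY Yx nXx] [/ZY Yy nXy]; apply: YX1.
Qed.

Lemma interleaving_stepU1 X x :
  X `<=` E -> E x -> ~ X x -> rces_step interleaving_rces X (x |` X).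
Proof.
move=> XE Ex nXx; apply/interleaving_stepE; split.
- by rewrite subUset; split=> // _ ->.
- by split=> [y|/(_ x (or_introl erefl))//]; right.
- by move=> y z [[->|//] _] [[->|//] _].
Qed.

Lemma interleaving_configsU1 X x :
  configs (rces_ts interleaving_rces) X -> E x ->
  configs (rces_ts interleaving_rces) (x |` X).
Proof.
move=> CX Ex; have [Xx|nXx] := pselect (X x).
  by rewrite setUidr // => _ ->.
have [XE Xfin RX] := CX; split.
- by rewrite subUset; split=> // _ ->.
- by rewrite finite_setU.
- exact: reachable_step RX (interleaving_stepU1 XE Ex nXx).
Qed.

Lemma interleaving_not_ses (s : SES U) :
  ~ is_subset1 E -> ~ trans_equiv (rces_ts interleaving_rces) (ses_ts s).
Proof.
apply: contra_not => Es x y Ex Ey.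
have C0 := configs0 (rces_ts interleaving_rces).
have C1 z : E z -> configs (rces_ts interleaving_rces) [set z].
  by rewrite -[[set z]]setU0; apply: interleaving_configsU1.
have S1 z : E z -> rces_step interleaving_rces set0 [set z].
  by move=> Ez; rewrite -[[set z]]setU0; apply: interleaving_stepU1.
have C2 : configs (rces_ts interleaving_rces) [set x; y].
  exact: interleaving_configsU1 (C1 y Ey) Ex.
have /interleaving_stepE[_ _ xy1] : rces_step interleaving_rces set0 [set x; y].
  exact: trans_equiv_ses_stepU Es C0 (C1 x Ex) (C1 y Ey) C2 (S1 x Ex) (S1 y Ey).
by apply: xy1; split=> //; [left | right].
Qed.

End Interleaving.

Theorem theorem4p20 :
  (forall (U : Type) (s : SES U),
     exists r : RCES U, trans_equiv (ses_ts s) (rces_ts r)) /\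
  (forall U : Type, infinite_set [set: U] ->
     exists r : RCES U, forall s : SES U,
       ~ trans_equiv (rces_ts r) (ses_ts s)).
Proof.
split=> [U s|U Uinf].
- by exists (rces_of_ses s); apply: trans_equiv_rces_of_ses.
- exists (interleaving_rces [set: U]) => s.
  by apply: interleaving_not_ses => /is_subset1_finite.
Qed.
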